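(* Let $k$ be an infinite field. Fix integers $d>d'>0$, and suppose that the polynomial $g_{d,d'}(x)$ has at most one sign-change in its coefficients. Then for any $n\ge 1$ such that, with $R=k[x_1,\dots,x_n]$, $\dim_k R_{d+d'}\ge (\dim_k R_{d'})^2$, we have that, for any positive integer $r$, there is an ideal $I$ of $R$ generated by $r$ forms of degree $d$ such that $\dim_k (R/I)_{d+d'}$ equals the value conjectured by Fröberg, namely $\max(\dim_k R_{d+d'}-r\dim_k R_{d'},\,0)$.
   Context: $R=k[x_1,\dots,x_n]$ is standard graded, $R_i$ is its degree $i$ part, and a form of degree $d$ is an element of $R_d$. For a real number or indeterminate $x$ and an integer $i\ge 1$, $\binom{x}{i}=\frac{x(x-1)\cdots(x-i+1)}{i!}$, and $\binom{x}{0}=1$. For $d>d'>0$, $$g_{d,d'}(x)=\frac{\binom{x+d+d'}{d}}{\binom{d+d'}{d}}-\binom{x+d'}{d'}.$$ The number of sign-changes in the coefficients of a real polynomial is the number of sign changes in its sequence of coefficients ordered by degree, with zeros omitted (as in Descartes' rule of signs). The value conjectured by Fröberg in degree $d+d'$ with $0<d'<d$ is the coefficient of $t^{d+d'}$ in $\frac{(1-t^d)^r}{(1-t)^n}$ truncated at its first non-positive coefficient, which equals $\max(\dim_k R_{d+d'}-r\dim_k R_{d'},0)$. *)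

(* Defs.v *)
From HB Require Import structures.
From mathcomp Require Import all_boot all_order all_algebra.
From mathcomp.multinomials Require Import mpoly.

Set Implicit Arguments.
Unset Strict Implicit.
Unset Printing Implicit Defensive.

Import GRing.Theory Num.Theory.
Local Open Scope ring_scope.

Definition infinite_field (k : fieldType) : Prop :=
  forall s : seq k, exists x : k, x \notin s.

(* The coefficients of g_{d,d'} are rational, so everything below about real
   polynomials is carried out in {poly rat}. *)

Definition binom_poly (p : {poly rat}) (i : nat) : {poly rat} :=
  (i`!%:R)^-1 *: \prod_(j < i) (p - j%:R).

Definition gpoly (d d' : nat) : {poly rat} :=
  ('C(d + d', d)%:R)^-1 *: binom_poly ('X + (d + d')%:R) d
    - binom_poly ('X + d'%:R) d'.

Definition sign_changes (p : {poly rat}) : nat :=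
  let s := [seq c <- polyseq p | c != 0] in
  count (fun ab : rat * rat => ab.1 * ab.2 < 0) (zip s (behead s)).

(* The type dhomog has its finite-dimensional structure only for a positive
   number of variables, which is why n + 1 variables are used from here on. *)

Definition dim_forms (k : fieldType) (n e : nat) : nat :=
  \dim (fullv : {vspace dhomog n.+1 k e}).

Definition ideal_gen (k : fieldType) (n r : nat) (f : 'I_r -> {mpoly k[n]}) :
    {mpoly k[n]} -> Prop :=
  fun p => exists a : 'I_r -> {mpoly k[n]}, p = \sum_(i < r) a i * f i.

(* The degree e part of R/I is R_e modulo the forms of degree e in I, and it has
   dimension m iff it is isomorphic to k^m, i.e. iff R_e maps linearly onto k^m
   with kernel the forms of degree e in I. *)
Definition quotient_dim (k : fieldType) (n : nat)
    (I : {mpoly k[n.+1]} -> Prop) (e m : nat) : Prop :=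
  exists phi : {linear dhomog n.+1 k e -> 'rV[k]_m},
    (forall v : 'rV[k]_m, exists p : dhomog n.+1 k e, phi p = v) /\
    (forall p : dhomog n.+1 k e, phi p = 0 <-> I (mpoly_of_dhomog p)).

(* Subtraction on nat is truncated, so this is max(dim R_{d+d'} - r dim R_{d'}, 0). *)
Definition froberg_value (k : fieldType) (n r d d' : nat) : nat :=
  (dim_forms k n (d + d') - r * dim_forms k n d')%N.

(* Main.v *)
From HB Require Import structures.
Require Import Defs.
From mathcomp Require Import all_boot all_order all_algebra.
From mathcomp.multinomials Require Import mpoly.
From mathcomp Require Import finfield realalg lra ring zify.

(* Let N, M be the dimensions of the forms of degree d' and d + d'. The rank of the
   multiplication map of r forms of degree d is maximal for some choice over k as soon
   as it is over one large finite field F of suitable characteristic, because its minors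
   are integer polynomials in the coefficients. Over F one counts: if the map is not
   injective there is a nonzero relation T (an r x N matrix), if it is not surjective
   there is a nonzero functional l on the forms of degree d + d' killing the image.
   Grouping the T (resp. l) by the row space of T (resp. of the catalecticant of l), the
   number of bad r-tuples is smaller than the number of all r-tuples provided that, for
   every b-dimensional space V of functionals in degree d', the space of functionals in
   degree d + d' all of whose contractions lie in V has dimension q with
   q / b - b <= M / N - N. A real-variable form of Macaulay's theorem gives
   q <= C(x + d + d', d + d') where b = C(x + d', d'), so q / b - b <= g_{d,d'}(x), while
   g_{d,d'}(n) = M / N - N in n + 1 variables; the sign-change hypothesis makes
   x^(-j) g_{d,d'}(x) increasing for some j, whence g_{d,d'}(x) <= g_{d,d'}(n). *)

Set Implicit Arguments.
Unset Strict Implicit.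
Unset Printing Implicit Defensive.

Import Order.TTheory GRing.Theory Num.Theory.
Local Open Scope ring_scope.

(** * Macaulay's theorem in real-variable form *)

(* The binomial coefficient C(x + i, i) for real x. *)
Definition rbin (R : realFieldType) (i : nat) (x : R) : R :=
  \prod_(l < i) ((x + l.+1%:R) / l.+1%:R).

Section Rbin.
Variable R : realFieldType.
Implicit Types x y t : R.

Lemma rbin0 x : rbin 0 x = 1.
Proof. by rewrite /rbin big_ord0. Qed.

Lemma rbinS i x : rbin i.+1 x = rbin i x * ((x + i.+1%:R) / i.+1%:R).
Proof. by rewrite /rbin big_ord_recr. Qed.

Lemma rbin_ge0 i x : -1 <= x -> 0 <= rbin i x.
Proof.
move=> x0; apply: prodr_ge0 => l _; apply: divr_ge0 => //.
by rewrite -natr1; have := ler0n R l; lra.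
Qed.

Lemma rbin_gt0 i x : 0 <= x -> 0 < rbin i x.
Proof.
by move=> x0; apply: prodr_gt0 => l _; rewrite divr_gt0 ?ltr_wpDl ?ltr0n.
Qed.

Lemma le_rbin i x y : -1 <= x -> x <= y -> rbin i x <= rbin i y.
Proof.
move=> x0 xy; apply: ler_prod => l _; apply/andP; split.
  apply: divr_ge0 => //; rewrite -natr1; have := ler0n R l; lra.
by rewrite ler_pM2r ?invr_gt0 ?ltr0n // lerD2r.
Qed.

(** Both sides equal x (x + 1) ... (x + i) / i!. *)
Lemma rbin_shiftM i x : x * rbin i x = (x + i%:R) * rbin i (x - 1).
Proof.
elim: i => [|i IH]; first by rewrite !rbin0 addr0.
rewrite !rbinS mulrA IH -!natr1.
have : (i%:R + 1 : R) != 0 by rewrite natr1 pnatr_eq0.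
by move=> h; field.
Qed.

Lemma rbin_pascal i x : rbin i.+1 x = rbin i.+1 (x - 1) + rbin i x.
Proof.
rewrite !rbinS -!natr1.
have h : (i%:R + 1 : R) != 0 by rewrite natr1 pnatr_eq0.
have e := rbin_shiftM i x.
have -> : rbin i x * ((x + (i%:R + 1)) / (i%:R + 1))
    = x * rbin i x / (i%:R + 1) + rbin i x by field.
by rewrite e; field.
Qed.

(** Equality holds at t = 0, and at t = 1 by [rbin_shiftM]. In the induction on [i] the two products
    of linear factors differ by exactly t (1 - t) (i + 1). *)
Lemma rbin_chord i x t : 0 <= x -> 0 <= t <= 1 ->
  x * rbin i x <= (x + i%:R * t) * rbin i (x - t).
Proof.
move=> x0 /andP[t0 t1]; elim: i => [|i IH]; first by rewrite !rbin0 mul0r addr0.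
rewrite !rbinS !mulrA.
rewrite ler_pM2r ?invr_gt0 ?ltr0n // -!natr1.
have i0 := ler0n R i.
have p0 : 0 <= rbin i (x - t) by apply: rbin_ge0; lra.
apply: (@le_trans _ _ ((x + i%:R * t) * rbin i (x - t) * (x + (i%:R + 1)))).
  by apply: ler_wpM2r => //; lra.
rewrite -!mulrA [rbin i _ * _]mulrC [rbin i _ * _]mulrC !mulrA.
apply: ler_wpM2r => //; have : 0 <= t * (1 - t) * (i%:R + 1).
  by rewrite !mulr_ge0 //; lra.
nra.
Qed.

Lemma rbin_nat i n : rbin i (n%:R : R) = 'C(i + n, i)%:R.
Proof.
elim: i => [|i IH]; first by rewrite rbin0 bin0.
have h : (i.+1%:R : R) != 0 by rewrite pnatr_eq0.
apply: (mulIf h); rewrite rbinS mulrA mulfVK // IH -natrD -!natrM.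
by rewrite [in RHS]mulnC -mul_bin_diag /= mulnC addnC.
Qed.

Lemma rbin_at0 i : rbin i (0 : R) = 1.
Proof. by rewrite -(mulr0n 1) rbin_nat addn0 binn. Qed.
End Rbin.

Lemma rbin_poly (R : realFieldType) i :
  exists p : {poly R}, forall x, p.[x] = rbin i x.
Proof.
exists (\prod_(l < i) ((l.+1%:R)^-1 *: ('X + (l.+1%:R)%:P))) => x.
rewrite horner_prod; apply: eq_bigr => l _.
by rewrite !hornerE mulrC.
Qed.

Lemma rbin_ivt (R : rcfType) i (b x : R) : 1 <= b -> 0 <= x -> b <= rbin i x ->
  exists2 y, 0 <= y <= x & rbin i y = b.
Proof.
move=> b1 x0 bx; have [p Hp] := rbin_poly R i.
have [|y yx /rootP] := @poly_ivt R (p - b%:P) 0 x x0.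
  by rewrite !hornerE !Hp rbin_at0 subr_le0 subr_ge0 b1.
by rewrite !hornerE Hp => /eqP; rewrite subr_eq0 => /eqP; exists y.
Qed.

Lemma rbin_lt1 (R : realFieldType) i (x : R) : -1 <= x < 0 -> rbin i.+1 x < 1.
Proof.
move=> /andP[x0 x1]; rewrite rbinS.
have h : rbin i x <= 1.
  by rewrite -(rbin_at0 R i) le_rbin // ltW.
have i0 : 0 < i.+1%:R :> R by rewrite ltr0n.
apply: le_lt_trans (_ : (x + i.+1%:R) / i.+1%:R < 1).
  rewrite -[leRHS]mul1r ler_wpM2r // divr_ge0 // -natr1.
  by have := ler0n R i; lra.
by rewrite ltr_pdivrMr // mul1r; lra.
Qed.

(* Convexity of C(y + i, i) |-> C(y + i + 1, i + 1), in the form of [rbin_chord],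
   settles the case where b1 is small; a large b1 is handled by Pascal's rule. *)
Lemma macaulay_split (R : rcfType) i (x b0 b1 c0 c1 : R) :
    0 <= x -> rbin i.+1 x = b1 + b0 -> c1 <= b1 + b0 ->
    b1 = 0 \/ 1 <= b1 -> b0 = 0 \/ 1 <= b0 ->
    (b1 = 0 -> c1 = 0) -> (b0 = 0 -> c0 = 0) ->
    (forall y : R, 0 <= y -> b0 <= rbin i.+1 y -> c0 <= rbin i.+2 y) ->
    (forall y : R, 0 <= y -> (0 < i)%N -> b1 <= rbin i y -> c1 <= rbin i.+1 y) ->
  c1 + c0 <= rbin i.+2 x.
Proof.
move=> x0 bE c1b [b1E|b1p] [b0E|b0p] hc1 hc0 H0 H1.
- by rewrite hc1 // hc0 // addr0 ltW // rbin_gt0.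
- by rewrite hc1 // add0r; apply: H0 => //; rewrite bE b1E add0r.
- rewrite hc0 // addr0 (le_trans c1b) // -bE [leRHS]rbinS.
  rewrite ler_peMr //; first by rewrite ltW ?rbin_gt0.
  by rewrite ler_pdivlMr ?ltr0n // mul1r; lra.
have [b1x|b1x] := leP (rbin i x) b1.
  have b0x : b0 <= rbin i.+1 (x - 1) by have := rbin_pascal i x; lra.
  have x1 : 0 <= x - 1.
    rewrite leNgt; apply/negP => x1.
    by have := @rbin_lt1 R i (x - 1); lra.
  by rewrite rbin_pascal bE addrC; apply: lerD; first exact: H0.
case: i bE H0 H1 b1x => [|i] bE H0 H1 b1x; first by rewrite rbin0 in b1x; lra.
(* With [b1] and [b0] written as binomials, the bound on [c1] is [b1] times (z + i + 2) / (i + 2),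
   where z <= x, and that on [c0] is [b0] times (y + i + 3) / (i + 3). The chord inequality with t =
   x - y compares their sum with [rbin i.+3 x]. *)
have [z /andP[z0 zx] zE] := rbin_ivt b1p x0 (ltW b1x).
have [|y /andP[y0 yx] yE] := @rbin_ivt R i.+2 b0 x b0p x0; first by lra.
(* This puts t in [0, 1]: [b1] is below [rbin i.+1 x], so by Pascal's rule [b0] exceeds
   [rbin i.+2 (x - 1)]. *)
have yx1 : x - 1 <= y.
  rewrite leNgt; apply/negP => yx1.
  have := @le_rbin R i.+2 y (x - 1); have := rbin_pascal i.+1 x; lra.
have {H0} := H0 y y0; rewrite yE lexx => /(_ isT).
have {H1} := H1 z z0 isT; rewrite zE lexx => /(_ isT).
have := @rbin_chord R i.+2 x (x - y) x0.
rewrite (_ : x - (x - y) = y); last by ring.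
rewrite [rbin i.+2 z]rbinS [rbin i.+3 y]rbinS [rbin i.+3 x]rbinS zE yE bE -!natr1.
move: (ler0n R i); move: (i%:R) => k k0 ch h1 h0.
have {}ch : x * (b1 + b0) <= (x + (k + 1 + 1) * (x - y)) * b0 by apply: ch; lra.
apply: le_trans (lerD h1 h0) _.
have k2 : 0 < k + 1 + 1 by lra.
have k3 : 0 < k + 1 + 1 + 1 by lra.
apply: (@le_trans _ _ (b1 * ((x + (k + 1 + 1)) / (k + 1 + 1)) +
    b0 * ((y + (k + 1 + 1 + 1)) / (k + 1 + 1 + 1)))).
  by rewrite lerD2r ler_wpM2l ?ler_wpM2r ?invr_ge0; lra.
rewrite -subr_ge0.
have -> : (b1 + b0) * ((x + (k + 1 + 1 + 1)) / (k + 1 + 1 + 1)) -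
   (b1 * ((x + (k + 1 + 1)) / (k + 1 + 1)) +
    b0 * ((y + (k + 1 + 1 + 1)) / (k + 1 + 1 + 1))) =
  ((x + (k + 1 + 1) * (x - y)) * b0 - x * (b1 + b0)) / (k + 1 + 1) / (k + 1 + 1 + 1).
  by field; lra.
by rewrite !divr_ge0 ?subr_ge0 //; lra.
Qed.

(* [D i] is a space of functionals in degree i, the [X j i] are the contractions by the
   variables, and [W] is contained in the prolongation of [V]. The induction splits V and
   W into the kernel and the image of contraction by the last variable. *)
Lemma macaulay_step (F : fieldType) (R : rcfType) (N : nat -> nat)
    (X : nat -> forall i, 'M[F]_(N i.+1, N i)) (m : nat)
    (D : forall i, 'M[F]_(N i)) :
    (forall j l i, (j < m)%N -> (l < m)%N ->
       X j i.+1 *m X l i = X l i.+1 *m X j i) ->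
    (forall j i, (j < m)%N -> (D i.+1 *m X j i <= D i)%MS) ->
    (forall i (v : 'rV_(N i.+1)), (v <= D i.+1)%MS ->
       (forall j, (j < m)%N -> v *m X j i = 0) -> v = 0) ->
    (\rank (D 0) <= 1)%N ->
  forall i p q (V : 'M_(p, N i.+1)) (W : 'M_(q, N i.+2)) (x : R),
    (V <= D i.+1)%MS -> (W <= D i.+2)%MS ->
    (forall j, (j < m)%N -> (W *m X j i.+1 <= V)%MS) ->
    0 <= x -> (\rank V)%:R <= rbin i.+1 x -> (\rank W)%:R <= rbin i.+2 x.
Proof.
elim: m D => [|m IHm] D comm hD hker h0.
  move=> i p q V W x _ WD _ x0 _.
  suff -> : W = 0 by rewrite mxrank0 ltW ?rbin_gt0.
  apply/row_matrixP => k; rewrite row0; apply: hker => //.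
  exact: submx_trans (row_sub k W) WD.
have W0 i p q (V : 'M_(p, N i)) (W : 'M_(q, N i.+1)) : (W <= D i.+1)%MS ->
    (forall j, (j < m.+1)%N -> (W *m X j i <= V)%MS) -> \rank V = 0%N -> \rank W = 0%N.
  move=> WD WV /eqP; rewrite mxrank_eq0 => /eqP V0.
  suff -> : W = 0 by rewrite mxrank0.
  apply/row_matrixP => k; rewrite row0; apply: hker => [|j jm].
    exact: submx_trans (row_sub k W) WD.
  have := WV j jm; rewrite V0 => /submx0null e.
  by rewrite -row_mul e row0.
(* [D'] holds the functionals killed by the last variable, so the other [m] variables detect them.
   No contraction leaves degree 0, where [D 0] is kept. *)
pose D' i : 'M[F]_(N i) := match i return 'M_(N i) with
  | 0 => D 0 | i.+1 => (D i.+1 :&: kermx (X m i))%MS end.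
have D'D i : (D' i <= D i)%MS by case: i => [|i] //=; apply: capmxSl.
have {}IHm := IHm D'.
have ltmS j : (j < m)%N -> (j < m.+1)%N by move/ltnW.
have kerc j i r (A : 'M_(r, N i.+2)) : (j < m)%N -> A *m X m i.+1 = 0 ->
    A *m X j i.+1 *m X m i = 0.
  by move=> jm A0; rewrite -mulmxA (comm j m _ (ltmS _ jm) (ltnSn m)) mulmxA A0 mul0mx.
have {}IHm : forall i p q (V : 'M_(p, N i.+1)) (W : 'M_(q, N i.+2)) (x : R),
    (V <= D' i.+1)%MS -> (W <= D' i.+2)%MS ->
    (forall j, (j < m)%N -> (W *m X j i.+1 <= V)%MS) ->
    0 <= x -> (\rank V)%:R <= rbin i.+1 x -> (\rank W)%:R <= rbin i.+2 x.
  apply: IHm => //.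
  - by move=> j l i jm lm; apply: comm; apply: ltmS.
  - move=> j [|i] jm.
      exact: submx_trans (submxMr _ (D'D 1%N)) (hD _ _ (ltmS _ jm)).
    rewrite sub_capmx (submx_trans (submxMr _ (D'D _)) (hD _ _ (ltmS _ jm))) /=.
    by apply/sub_kermxP; apply: kerc => //; apply/sub_kermxP/capmxSr.
  - move=> i v vD vX; apply: hker => [|j]; first exact: submx_trans vD (D'D _).
    rewrite ltnS leq_eqVlt => /orP[/eqP->|]; last exact: vX.
    by apply/sub_kermxP; apply: submx_trans vD (capmxSr _ _).
have step i : ((0 < i)%N -> forall p q (V : 'M_(p, N i)) (W : 'M_(q, N i.+1)) (x : R),
    (V <= D i)%MS -> (W <= D i.+1)%MS ->
    (forall j, (j < m.+1)%N -> (W *m X j i <= V)%MS) ->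
    0 <= x -> (\rank V)%:R <= rbin i x -> (\rank W)%:R <= rbin i.+1 x) ->
  forall p q (V : 'M_(p, N i.+1)) (W : 'M_(q, N i.+2)) (x : R),
    (V <= D i.+1)%MS -> (W <= D i.+2)%MS ->
    (forall j, (j < m.+1)%N -> (W *m X j i.+1 <= V)%MS) ->
    0 <= x -> (\rank V)%:R <= rbin i.+1 x -> (\rank W)%:R <= rbin i.+2 x.
  move=> IHi p q V W x VD WD WV x0 Vx.
  have [/(W0 _ _ _ _ _ WD WV)-> | bn0] := eqVneq (\rank V) 0%N.
    by rewrite ltW ?rbin_gt0.
  have nat01 k : k%:R = 0 :> R \/ 1 <= k%:R :> R.
    by case: k => [|k]; [left|right; rewrite ler1n].
  have b1 : 1 <= (\rank V)%:R :> R by rewrite ler1n lt0n.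
  (* [macaulay_split] needs the rank of [V] to be an exact value of [rbin], so x is lowered to y. *)
  have [y /andP[y0 yx] yE] := rbin_ivt b1 x0 Vx.
  apply: le_trans (_ : rbin i.+2 y <= _); last by apply: le_rbin => //; lra.
  have WVm := WV m (ltnSn m).
  rewrite -(mxrank_mul_ker W (X m i.+1)) natrD.
  have V0D : (V :&: kermx (X m i) <= D' i.+1)%MS by rewrite capmxS.
  have W0D : (W :&: kermx (X m i.+1) <= D' i.+2)%MS by rewrite capmxS.
  have W0V0 j : (j < m)%N ->
      ((W :&: kermx (X m i.+1))%MS *m X j i.+1 <= V :&: kermx (X m i))%MS.
    move=> jm; rewrite sub_capmx (submx_trans (submxMr _ (capmxSl _ _))) ?WV ?ltmS //=.
    by apply/sub_kermxP; apply: kerc => //; apply/sub_kermxP/capmxSr.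
  have V1D : (V *m X m i <= D i)%MS by apply: submx_trans (submxMr _ VD) (hD _ _ _).
  have W1D : (W *m X m i.+1 <= D i.+1)%MS.
    by apply: submx_trans (submxMr _ WD) (hD _ _ _).
  have W1V1 j : (j < m.+1)%N -> (W *m X m i.+1 *m X j i <= V *m X m i)%MS.
    by move=> jm; rewrite -mulmxA (comm m j) // mulmxA submxMr ?WV.
  (* The kernels fall under the induction on the number of variables, the images under the one on
     the degree. The image of [W] lies in [V], which bounds its rank by that of [V]. *)
  apply: (@macaulay_split R i y
    (\rank (V :&: kermx (X m i)))%:R (\rank (V *m X m i))%:R).
  - by [].
  - by rewrite -natrD mxrank_mul_ker.
  - by rewrite -natrD mxrank_mul_ker ler_nat mxrankS.
  - exact: nat01.
  - exact: nat01.
  - by move/eqP; rewrite pnatr_eq0 => /eqP /(W0 _ _ _ _ _ W1D W1V1) ->.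
  - move/eqP; rewrite pnatr_eq0 => /eqP r0; rewrite (W0 _ _ _ _ _ _ _ r0) //.
      exact: submx_trans W0D (D'D _).
    move=> j; rewrite ltnS leq_eqVlt => /orP[/eqP->|]; last exact: W0V0.
    by have /sub_kermxP -> := capmxSr W (kermx (X m i.+1)); exact: sub0mx.
  - by move=> z z0; apply: IHm.
  - by move=> z z0 i0; apply: IHi.
elim=> [|i IHi]; apply: step => // _; exact: IHi.
Qed.

(** * Contractions of functionals on forms *)

Definition nmon (n e : nat) := 'C(e + n, e).

(** The default [0%MM] is never reached: by [size_basis] the list has [nmon n e] entries. *)
Definition mon (n e : nat) (i : 'I_(nmon n e)) : 'X_{1..n.+1} :=
  nth 0%MM [seq s2m t | t : e.-tuple 'I_n.+1 <- enum (basis n.+1 e)] i.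

Lemma mdeg_mon n e (i : 'I_(nmon n e)) : mdeg (mon i) = e.
Proof. by apply/eqP; rewrite basis_cover mem_nth // size_basis. Qed.

Lemma mon_inj n e : injective (@mon n e).
Proof.
move=> i j /eqP; rewrite nth_uniq ?size_basis ?uniq_basis //.
by move/eqP/val_inj.
Qed.

Lemma mon_surj n e (m : 'X_{1..n.+1}) : mdeg m = e ->
  exists i : 'I_(nmon n e), mon i = m.
Proof.
move/eqP; rewrite basis_cover => mb.
have := mb; rewrite -index_mem size_basis => lt.
by exists (Ordinal lt); rewrite /mon nth_index.
Qed.

Section Contraction.
Variables (F : nzRingType) (n : nat).

(* A functional on the forms of degree s is the row of its values on the monomials;
   [contr s t b] is then the transpose of multiplication by 'X_[b] in degree t. *)
Definition contr (s t : nat) (b : 'X_{1..n.+1}) : 'M[F]_(nmon n s, nmon n t) :=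
  \matrix_(c, a) (mon c == (mon a + b)%MM)%:R.

Lemma contrM p s t (U : 'M[F]_(p, nmon n s)) b i (a : 'I_(nmon n t)) c :
  mon c = (mon a + b)%MM -> (U *m contr s t b) i a = U i c.
Proof.
move=> cE; rewrite mxE (bigD1 c) //= mxE cE eqxx mulr1 big1 ?addr0 // => j jc.
by rewrite mxE -cE (inj_eq (@mon_inj _ _)) (negbTE jc) mulr0.
Qed.

Lemma contr_mul s t u b b' : (mdeg b' + u = t)%N ->
  contr s t b *m contr t u b' = contr s u (b' + b).
Proof.
move=> tE; apply/matrixP => i a.
have [|c cE] := @mon_surj n t (mon a + b').
  by rewrite mdegD mdeg_mon addnC.
by rewrite (contrM _ _ cE) !mxE cE addmA.
Qed.

Lemma contr0 s : contr s s 0 = 1%:M.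
Proof. by apply/matrixP => i j; rewrite !mxE addm0 (inj_eq (@mon_inj _ _)). Qed.
End Contraction.

Section Prolong.
Variables (F : fieldType) (n : nat).

(** A monomial of positive degree is divisible by some variable, so every entry of [U] reappears in
    some contraction. *)
Lemma contr1_eq0 s p (U : 'M[F]_(p, nmon n s.+1)) :
  (forall j, U *m contr F s.+1 s U_(j) = 0) -> U = 0.
Proof.
move=> U0; apply/matrixP => i c; rewrite mxE.
have /existsP[j cj] : [exists j, mon c j != 0%N].
  apply: contraT; rewrite negb_exists => /forallP c0.
  have := mdeg_mon c; rewrite mdegE big1 // => j _.
  by apply/eqP; have := c0 j; rewrite negbK.
have cE : mon c = (mon c - U_(j) + U_(j))%MM by rewrite submK // lep1mP.
have [|a aE] := @mon_surj n s (mon c - U_(j)).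
  by have := mdeg_mon c; rewrite {1}cE mdegD mdeg1 addn1 => -[].
by rewrite -(@contrM F n p s.+1 s U U_(j) i a c) ?U0 ?mxE // aE.
Qed.

Lemma contr_eq0 d i p (U : 'M[F]_(p, nmon n (d + i))) :
  (forall b : 'X_{1..n.+1}, mdeg b = d -> U *m contr F (d + i) i b = 0) -> U = 0.
Proof.
elim: d U => [|d IHd] U U0.
  by have := U0 0%MM mdeg0; rewrite contr0 mulmx1.
apply: contr1_eq0 => j; apply: IHd => b bd.
by rewrite -mulmxA contr_mul ?bd // U0 // mdegD mdeg1 bd addn1.
Qed.

(** Iterates [macaulay_step]: the space [V'] spanned by the contractions of [U] by the variables
    satisfies the hypothesis with d lowered by one, and [U] lies in its prolongation. *)
Lemma rank_prolong (R : rcfType) d i e p q (V : 'M[F]_(p, nmon n i.+1))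
    (U : 'M[F]_(q, nmon n e)) (x : R) : e = (d + i.+1)%N ->
    (forall b : 'X_{1..n.+1}, mdeg b = d -> (U *m contr F e i.+1 b <= V)%MS) ->
    0 <= x -> (\rank V)%:R <= rbin i.+1 x -> (\rank U)%:R <= rbin e x.
Proof.
move=> eE UV x0 Vx; elim: d e eE q U UV => [|d IHd] e eE q U UV; subst e.
  apply: le_trans Vx; rewrite ler_nat; have := UV 0%MM mdeg0.
  by rewrite contr0 mulmx1; apply: mxrankS.
have eS : (d.+1 + i.+1 = (d + i).+2)%N by rewrite addSn addnS.
move: U UV; rewrite eS => U UV.
pose V' := (\sum_(j < n.+1) <<U *m contr F (d + i).+2 (d + i).+1 U_(j)>>)%MS.
have {}IHd : (\rank V')%:R <= rbin (d + i).+1 x.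
  apply: IHd => [|b bd]; first by rewrite addnS.
  rewrite sumsmxMr_gen; apply/sumsmx_subP => j _.
  rewrite genmxE (eqmxMr _ (genmxE _)) -mulmxA.
  by rewrite contr_mul ?bd ?addnS // UV // mdegD mdeg1 bd addn1.
pose X j i := contr F i.+1 i (U_(inord j : 'I_n.+1)).
apply: (@macaulay_step F R (nmon n) X n.+1 (fun _ => 1%:M)) IHd => //.
- by move=> j l k _ _; rewrite /X !contr_mul ?mdeg1 // addmC.
- by move=> *; exact: submx1.
- move=> k v _ v0; apply: contr1_eq0 => j.
  by have := v0 j (ltn_ord j); rewrite /X inord_val.
- by rewrite (leq_trans (rank_leq_row _)) // /nmon bin0.
- exact: submx1.
- exact: submx1.
- by move=> j jn; apply: (sumsmx_sup (inord j)); rewrite ?genmxE.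
Qed.
End Prolong.

(** * Sign changes *)

Section Signs.
Variable K : realFieldType.
Implicit Types s t : seq K.

Definition sgnch s :=
  count (fun ab : K * K => ab.1 * ab.2 < 0) (zip s (behead s)).

Lemma sgnch_cons a b s : sgnch [:: a, b & s] = ((a * b < 0)%R + sgnch (b :: s))%N.
Proof. by []. Qed.

Lemma sgnch0_last a s : all (fun c => c != 0) (a :: s) ->
  sgnch (a :: s) = 0%N -> 0 < last a s -> 0 < a.
Proof.
elim: s a => [|b s IHs] a //= /and3P[a0 b0 s0]; rewrite sgnch_cons.
case: ltrP => //= ab sc lst.
have b1 : 0 < b by apply: IHs => //=; rewrite b0.
by rewrite pmulr_lge0 // in ab; rewrite lt_def a0.
Qed.

(** A positive last entry leaves room only for a negative block followed by a positive one. The last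
    clause serves the induction. *)
Lemma sgnch1_split a s : all (fun c => c != 0) (a :: s) ->
  (sgnch (a :: s) <= 1)%N -> 0 < last a s ->
  exists s1 s2, [/\ a :: s = s1 ++ s2, all (fun c => c < 0) s1,
     all (fun c => 0 < c) s2 & 0 < a -> s1 = [::]].
Proof.
elim: s a => [|b s IHs] a /=.
  by move=> _ _ a0; exists [::], [:: a]; rewrite /= a0.
move=> /and3P[a0 b0 s0]; rewrite sgnch_cons => sc lst.
have bs0 : all (fun c => c != 0) (b :: s) by rewrite /= b0.
have [||s1 [s2 [E n1 p2 hb]]] := IHs b bs0; [|by []|].
  exact: leq_trans (leq_addl _ _) sc.
case: (ltrP a 0) => a1.
  exists (a :: s1), s2; split => //=; first by rewrite E.
    by rewrite a1.
  by move=> /(lt_trans a1); rewrite ltxx.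
have {a1}a1 : 0 < a by rewrite lt_def a0.
have b1 : 0 < b.
  rewrite lt_def b0 leNgt; apply/negP => b1.
  have := sc; rewrite pmulr_rlt0 // b1 add1n ltnS leqn0 => /eqP sc0.
  by have := lt_trans b1 (sgnch0_last bs0 sc0 lst); rewrite ltxx.
exists [::], (a :: b :: s); split => //=.
by move: p2; rewrite a1 /= -[s2]cat0s -(hb b1) -E.
Qed.

Lemma filter_split s s1 s2 : [seq c <- s | c != 0] = s1 ++ s2 ->
  all (fun c => c < 0) s1 -> all (fun c => 0 < c) s2 ->
  exists j, forall i, if (i < j)%N then s`_i <= 0 else 0 <= s`_i.
Proof.
elim: s s1 => [|a s IHs] s1 /=; first by exists 0%N => i; rewrite nth_nil /= lexx.
have [->|a0] := eqVneq a 0 => /=.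
  move=> E n1 p2; have [j Hj] := IHs s1 E n1 p2.
  by exists j.+1 => -[|i] /=; [rewrite lexx | exact: Hj].
case: s1 => [|a' s1] /= E.
  move=> _; rewrite -E /= => /andP[ap sp]; exists 0%N => -[|i] /=; first exact: ltW.
  have [i_s|] := ltnP i (size s); last by move=> ?; rewrite nth_default.
  have := mem_nth 0 i_s; move: (s`_i) => c cs.
  have [->//|c0] := eqVneq c 0.
  by apply/ltW/(allP sp); rewrite mem_filter c0.
case: E => -> E /andP[n0 n1] p2; have [j Hj] := IHs s1 E n1 p2.
by exists j.+1 => -[|i] /=; [exact: ltW | exact: Hj].
Qed.
End Signs.

Lemma sign_changes_split (p : {poly rat}) : (sign_changes p <= 1)%N ->
  0 < lead_coef p ->
  exists j, forall i, if (i < j)%N then p`_i <= 0 else 0 <= p`_i.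
Proof.
rewrite /sign_changes -/(sgnch _) => sc lp.
set s := filter _ _ in sc.
have s0 : all (fun c => c != 0) s by exact: filter_all.
have ls : 0 < last 0 s.
  move: lp; rewrite lead_coefE nth_last /s.
  case/lastP: (polyseq p) => [|t a]; first by rewrite /= ltxx.
  rewrite last_rcons filter_rcons => a0.
  by rewrite gt_eqF //= last_rcons.
case E: s s0 sc ls => [|a t] s0 sc ls; first by rewrite ltxx in ls.
have [s1 [s2 [E' n1 p2 _]]] := sgnch1_split s0 sc ls.
by apply: filter_split n1 p2; rewrite -E'.
Qed.

(** Put u = x / y <= 1. A coefficient below the index j is nonpositive and one from j on is
    nonnegative, so replacing u^i by u^j increases every term. Hence p(x) <= u^j p(y), and p(y) >= 0
    lets u^j be dropped. *)
Lemma sign_changes_le (R : realFieldType) (p : {poly rat}) (x y : R) :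
  (sign_changes p <= 1)%N -> 0 < lead_coef p -> 0 <= x <= y ->
  0 <= (map_poly ratr p).[y] -> (map_poly ratr p).[x] <= (map_poly ratr p).[y].
Proof.
move=> sc lp /andP[x0 xy] py; have [j Hj] := sign_changes_split sc lp.
have [yE|y_neq0] := eqVneq y 0.
  by rewrite (_ : x = y) //; apply: le_anti; rewrite xy yE.
have y0 : 0 < y by rewrite lt_def y_neq0 (le_trans x0).
pose u := x / y; have u0 : 0 <= u by rewrite divr_ge0 // ltW.
have u1 : u <= 1 by rewrite ler_pdivrMr // mul1r.
have xE : x = u * y by rewrite mulfVK.
apply: le_trans (_ : u ^+ j * (map_poly ratr p).[y] <= _); last first.
  by rewrite ler_piMl // exprn_ile1.
rewrite !horner_coef mulr_sumr; apply: ler_sum => i _.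
rewrite coef_map /= xE exprMn mulrA [leRHS]mulrA [u ^+ j * _]mulrC.
rewrite ler_wpM2r ?exprn_ge0 ?(ltW y0) //.
have := Hj i; case: ltnP => ij pi.
  by apply: ler_wnM2l; [rewrite lerq0 | apply: ler_wiXn2l => //; exact: ltnW].
by apply: ler_wpM2l; [rewrite ler0q | exact: ler_wiXn2l].
Qed.

(** * The polynomial g at real arguments and the resulting rank bound *)

Lemma size_binom_poly (c : rat) i : size (binom_poly ('X + c%:P) i) = i.+1 /\
  lead_coef (binom_poly ('X + c%:P) i) = (i`!%:R)^-1.
Proof.
have f0 : (i`!%:R)^-1 != 0 :> rat by rewrite invr_eq0 pnatr_eq0 -lt0n fact_gt0.
rewrite /binom_poly lead_coefZ size_scale //.
rewrite (eq_bigr (fun j : 'I_i => 'X - (j%:R - c)%:P)); last first.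
  by move=> j _; rewrite polyCB opprB addrA polyC_natr.
rewrite size_prod_XsubC lead_coef_prod_XsubC mulr1.
by rewrite -[index_enum _]enumT size_enum_ord.
Qed.

Lemma lead_coef_gpoly d d' : (d' < d)%N -> 0 < lead_coef (gpoly d d').
Proof.
move=> hd; have [s1 l1] := size_binom_poly (d + d')%:R d.
have [s2 l2] := size_binom_poly d'%:R d'.
rewrite !polyC_natr in s1 l1 s2 l2.
have c0 : 0 < ('C(d + d', d)%:R)^-1 :> rat by rewrite invr_gt0 ltr0n bin_gt0 leq_addr.
rewrite /gpoly lead_coefDl; last first.
  by rewrite size_polyN s2 (size_scale _ (lt0r_neq0 c0)) s1.
by rewrite lead_coefZ l1 mulr_gt0 // invr_gt0 ltr0n fact_gt0.
Qed.

Section GpolyEval.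
Variable R : realFieldType.
Implicit Types x : R.

Lemma rbin_fact i x : rbin i x * i`!%:R = \prod_(j < i) (x + i%:R - j%:R).
Proof.
rewrite (reindex_inj rev_ord_inj) /=.
transitivity (\prod_(j < i) (x + j.+1%:R)); last first.
  by apply: eq_bigr => j _; rewrite natrB ?ltn_ord //; ring.
elim: i => [|i IH]; first by rewrite rbin0 big_ord0 mulr1.
rewrite big_ord_recr /= -IH rbinS factS natrM.
have h : (i.+1%:R : R) != 0 by rewrite pnatr_eq0.
by field; rewrite nat1r.
Qed.

Lemma horner_binom_poly c i x :
  (map_poly ratr (binom_poly ('X + c%:R) i)).[x] =
  (i`!%:R)^-1 * \prod_(j < i) (x + c%:R - j%:R).
Proof.
rewrite /binom_poly map_polyZ hornerZ /= fmorphV rmorph_nat; congr (_ * _).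
rewrite rmorph_prod horner_prod; apply: eq_bigr => j _.
by rewrite rmorphB rmorphD /= map_polyX !rmorph_nat -!polyC_natr !hornerE.
Qed.

(** The factor [rbin d' x] completes the product of d factors in the first term of g to one of d +
    d' factors. *)
Lemma gpoly_eval d d' x :
  rbin d' x * (map_poly ratr (gpoly d d')).[x] = rbin (d + d') x - rbin d' x ^+ 2.
Proof.
rewrite /gpoly rmorphB hornerD hornerN /= map_polyZ hornerZ !horner_binom_poly.
rewrite -rbin_fact [_^-1 * (rbin d' x * _)]mulrC mulfK ?pnatr_eq0 -?lt0n ?fact_gt0 //.
rewrite mulrBr -expr2; congr (_ - _).
have e0 : (d + d')`!%:R != 0 :> R by rewrite pnatr_eq0 -lt0n fact_gt0.
apply: (mulIf e0); rewrite rbin_fact big_split_ord /=.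
have -> : \prod_(j < d') (x + (d + d')%:R - (d + j)%:R) = rbin d' x * d'`!%:R.
  by rewrite rbin_fact; apply: eq_bigr => j _; rewrite !natrD; ring.
rewrite fmorphV rmorph_nat -(bin_fact (leq_addr d' d)) addKn !natrM.
have : 'C(d + d', d)%:R != 0 :> R by rewrite pnatr_eq0 -lt0n bin_gt0 leq_addr.
have : d`!%:R != 0 :> R by rewrite pnatr_eq0 -lt0n fact_gt0.
by move=> *; field; apply/andP.
Qed.
End GpolyEval.

(** This is q / b - b <= M / N - N with denominators cleared, for b, q the ranks of [V], [U] and N,
    M the numbers of monomials. *)
Lemma rank_catalecticant (F : fieldType) n d d' p q
    (V : 'M[F]_(p, nmon n d')) (U : 'M[F]_(q, nmon n (d + d'))) :
    (0 < d')%N -> (d' < d)%N -> (sign_changes (gpoly d d') <= 1)%N ->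
    (nmon n d' ^ 2 <= nmon n (d + d'))%N ->
    (forall b : 'X_{1..n.+1}, mdeg b = d -> (U *m contr F (d + d') d' b <= V)%MS) ->
  (nmon n d' * \rank U + \rank V * nmon n d' ^ 2 <=
   \rank V * nmon n (d + d') + nmon n d' * \rank V ^ 2)%N.
Proof.
move=> d'0 hd sc hn UV.
(* Rank 0 is not a value of [rbin] on [0, n], so it is treated apart. *)
have [V0|Vn0] := posnP (\rank V).
  suff -> : U = 0 by rewrite V0 mxrank0 muln0.
  apply: contr_eq0 => b bd; apply: submx0null (_ : (_ <= (0 : 'M_(p, _)))%MS).
  by have := UV b bd; move/eqP: V0; rewrite mxrank_eq0 => /eqP ->.
have b1 : 1 <= (\rank V)%:R :> realalg by rewrite ler1n.
have bN : (\rank V)%:R <= rbin d' (n%:R : realalg).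
  by rewrite rbin_nat ler_nat rank_leq_col.
have [x /andP[x0 xn] xE] := rbin_ivt b1 (ler0n _ n) bN.
have qx : (\rank U)%:R <= rbin (d + d') x.
  case: d' d'0 V U UV {hd sc hn Vn0 b1 bN} xE => // i _ V U UV xE.
  by apply: (rank_prolong (erefl _) UV x0); rewrite xE.
have gx := gpoly_eval d d' x; have gn := gpoly_eval d d' (n%:R : realalg).
rewrite !rbin_nat -!/(nmon _ _) in gn; rewrite xE in gx.
have N0 : 0 < (nmon n d')%:R :> realalg by rewrite ltr0n bin_gt0 leq_addr.
have := @sign_changes_le realalg (gpoly d d') x n%:R sc (lead_coef_gpoly hd).
rewrite x0 xn => /(_ isT).
set pR := map_poly _ _ in gx gn *; move: pR.[x] pR.[n%:R] gx gn => g0 g1 gx gn.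
have hn' : (nmon n d')%:R ^+ 2 <= (nmon n (d + d'))%:R :> realalg.
  by rewrite -natrX ler_nat.
have g1_ge0 : 0 <= g1 by rewrite -(pmulr_rge0 _ N0) gn subr_ge0.
move/(_ g1_ge0) => g01.
rewrite -(ler_nat realalg) !natrD !natrM.
set N := (nmon n d')%:R in N0 gn hn' *; set M := (nmon n (d + d'))%:R in gn hn' *.
set b := (\rank V)%:R in b1 bN xE gx *; set q' := (\rank U)%:R in qx *.
have h1 : N * q' <= N * (b * g0 + b ^+ 2).
  by rewrite ler_pM2l // gx; lra.
have h2 : N * b * g0 <= N * b * g1 by apply: ler_wpM2l => //; rewrite mulr_ge0; lra.
have -> : M = N * g1 + N ^+ 2 by rewrite gn; ring.
by rewrite expr2 in h1; rewrite !expr2; lra.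
Qed.

(** * Counting over finite fields *)

Lemma card_le_sum (T I : finType) (P : pred I) (A : {set T}) (S : I -> {set T}) :
  (forall x, x \in A -> exists2 i, P i & x \in S i) ->
  (#|A| <= \sum_(i | P i) #|S i|)%N.
Proof.
move=> cov; apply: leq_trans (_ : #|\bigcup_(i | P i) S i| <= _)%N.
  apply/subset_leq_card/subsetP => x /cov[i Pi xi].
  by apply/bigcupP; exists i.
elim/big_rec2: _ => [|i n B _ le]; first by rewrite cards0.
by rewrite (leq_trans (leq_card_setU _ _)) // leq_add2l.
Qed.

Section FiniteFieldCounting.
Variable F : finFieldType.

Lemma card_submx r p n (A : 'M[F]_(p, n)) :
  (#|[set f : 'M[F]_(r, n) | (f <= A)%MS]| <= #|F| ^ (r * \rank A))%N.
Proof.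
rewrite -(card_mx F r (\rank A)) -cardsT.
apply: leq_trans (leq_imset_card (fun g : 'M_(r, \rank A) => g *m row_base A) _).
apply/subset_leq_card/subsetP => f; rewrite inE -(eq_row_base A).
by case/submxP => g ->; apply: imset_f; rewrite inE.
Qed.

(* Every a-dimensional subspace of F^n is the row space of a matrix that restricts to
   the identity on some a columns; there are about q^(a (n - a)) of them. *)
Definition subspace_frames a n : {set 'M[F]_(a, n)} :=
  [set X | [exists f : {ffun 'I_a -> 'I_n}, injectiveb f && (rowsub f X^T == 1%:M)]].

Lemma rank_subspace_frame a n (X : 'M[F]_(a, n)) :
  X \in subspace_frames a n -> \rank X = a.
Proof.
rewrite inE => /existsP[f /andP[_ /eqP Xf]]; apply/eqP.
rewrite eqn_leq rank_leq_row -[leqLHS](mxrank1 F a) -Xf -[\rank X]mxrank_tr.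
by rewrite rowsubE mxrankM_maxr.
Qed.

(** There are at most n^a choices of the identity columns, and a (n - a) entries remain free. *)
Lemma card_subspace_frames a n :
  (#|subspace_frames a n| <= n ^ a * #|F| ^ (a * (n - a)))%N.
Proof.
pose S (f : {ffun 'I_a -> 'I_n}) : {set 'M[F]_(a, n)} := [set X | rowsub f X^T == 1%:M].
pose inj (f : {ffun 'I_a -> 'I_n}) := injectiveb f.
apply: leq_trans (card_le_sum (P := inj) (S := S) _) _.
  by move=> X; rewrite inE => /existsP[f /andP[fi fX]]; exists f; rewrite // inE.
have -> : (n ^ a)%N = #|{: {ffun 'I_a -> 'I_n}}| by rewrite card_ffun !card_ord.
apply: leq_trans (_ : (\sum_(f | inj f) #|F| ^ (a * (n - a)) <= _)%N); last first.
  by rewrite sum_nat_const leq_mul2r max_card orbT.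
apply: leq_sum => f /injectiveP fi.
pose rest (X : 'M[F]_(a, n)) :=
  [ffun p : 'I_a * {j | j \notin codom f} => X p.1 (val p.2)].
have -> : (a * (n - a))%N = #|{: 'I_a * {j | j \notin codom f}}|.
  rewrite card_prod card_ord card_sig; congr (_ * _)%N.
  have := cardC (mem (codom f)); rewrite card_codom // !card_ord => nE.
  rewrite (_ : (n - a)%N = #|[predC codom f]|); last by rewrite -(addKn a #|_|) nE.
  apply: eq_card => j.
  by rewrite !inE.
rewrite -card_ffun -(card_in_imset (f := rest)) ?max_card // => X Y.
rewrite !inE => /eqP Xf /eqP Yf eXY; apply/matrixP => i j.
have [/codomP[k ->]|jf] := boolP (j \in codom f).
  by move/matrixP/(_ k i): Xf; move/matrixP/(_ k i): Yf; rewrite !mxE => -> ->.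
by have /ffunP/(_ (i, Sub j jf)) := eXY; rewrite !ffunE.
Qed.

(** A row basis of [A] is normalised by inverting the block on a maximal set of independent
    columns. *)
Lemma subspace_frameP p n (A : 'M[F]_(p, n)) :
  exists2 X, X \in subspace_frames (\rank A) n & (A <= X)%MS.
Proof.
have rB : row_full (row_base A)^T by rewrite /row_full mxrank_tr eq_row_base.
pose f := fullrankfun rB; pose Y := rowsub f (row_base A)^T.
have Yu : Y \in unitmx by exact: fullrowsub_unit.
exists ((invmx Y)^T *m row_base A); last first.
  by rewrite eqmxMfull ?eq_row_base // row_full_unit unitmx_tr unitmx_inv.
rewrite inE; apply/existsP; exists f; apply/andP; split.
  by apply/injectiveP; exact: fullrankfun_inj.
by rewrite trmx_mul trmxK -mul_rowsub_mx mulmxV.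
Qed.
(* The scalar multiples of a nonzero [T] all exclude the same elements of [J],
   which is what gains the factor [#|F| - 1]. *)
Lemma exists_avoiding m n (J : finType) (Z : 'M[F]_(m, n) -> {set J})
    (w : 'M[F]_(m, n) -> nat) (z : nat -> nat) (h K : nat) :
    (0 < #|J|)%N ->
    (forall c T, c != 0 -> Z (c *: T) = Z T) ->
    (forall T, (w T <= h)%N) -> (forall T, (#|Z T| <= z (w T))%N) ->
    (forall a, (a <= h)%N -> (#|[set T | w T == a]| * z a <= K * #|J|)%N) ->
    (h.+1 * K < #|F|.-1)%N ->
  exists f, forall T, T != 0 -> f \notin Z T.
Proof.
move=> J0 Zscale wh Zz cnt hK.
suff /existsP[f /forallP Hf] : [exists f, [forall T, (T != 0) ==> (f \notin Z T)]].
  by exists f => T; exact/implyP.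
apply: contraLR hK.
rewrite negb_exists -leqNgt => /forallP bad.
rewrite -(leq_pmul2r J0) [X in (X <= _)%N]mulnC.
apply: leq_trans (_ : \sum_f #|[set T | (T != 0%R) && (f \in Z T)]| <= _)%N.
  rewrite -sum_nat_const; apply: leq_sum => f _.
  have := bad f; rewrite negb_forall => /existsP[T].
  rewrite negb_imply negbK => /andP[T0 fT].
  have cardU : #|[set c : F | c != 0]| = #|F|.-1.
    by have := cardsC1 (0 : F) => <-; apply: eq_card => c; rewrite !inE.
  rewrite -cardU -(card_imset _ (f := fun c => c *: T)).
    apply/subset_leq_card/subsetP => T' /imsetP[c]; rewrite inE => c0 ->.
    by rewrite inE Zscale // fT scaler_eq0 negb_or c0 T0.
  move=> c c' /eqP; rewrite -subr_eq0 -scalerBl scaler_eq0 (negbTE T0) orbF subr_eq0.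
  by move/eqP.
(* The pairs of a nonzero T and an f in [Z T] are now counted by T. *)
apply: leq_trans (_ : \sum_T #|Z T| <= _)%N.
  under eq_bigr do rewrite -sum1_card.
  under [X in (_ <= X)%N]eq_bigr do rewrite -sum1_card.
  rewrite (exchange_big_dep predT) //=; apply: leq_sum => T _.
  rewrite [X in (X <= _)%N]big_mkcond [X in (_ <= X)%N]big_mkcond.
  by apply: leq_sum => f _; rewrite !inE; case: (T != 0); case: (f \in Z T).
(* There are h + 1 possible values of [w], each contributing at most K times the size of [J]. *)
rewrite (partition_big (fun T => inord (w T) : 'I_h.+1) predT) //=.
rewrite -mulnA -[h.+1 in leqRHS]card_ord -sum_nat_const; apply: leq_sum => a _.
apply: leq_trans (cnt a (ltnSE (ltn_ord a))).
rewrite -sum_nat_const; under [X in (_ <= X)%N]eq_bigl do rewrite inE.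
rewrite big_mkcond [X in (_ <= X)%N]big_mkcond; apply: leq_sum => T _.
have -> : (inord (w T) == a) = (w T == a) by rewrite -val_eqE /= inordK ?ltnS.
by case: eqP => // <-.
Qed.
End FiniteFieldCounting.

(** * Catalecticants and the multiplication map *)

Section Catalecticant.
Variables (R : comNzRingType) (n d d' r : nat).

(** The entry at (b, a) is the value of [l] on the product of the monomials [mon b] and [mon a]. *)
Definition catal (l : 'rV[R]_(nmon n (d + d'))) : 'M[R]_(nmon n d, nmon n d') :=
  \matrix_(b, a) (l *m contr R (d + d') d' (mon b)) 0 a.

Lemma row_catal l b : row b (catal l) = l *m contr R (d + d') d' (mon b).
Proof. by apply/rowP => a; rewrite !mxE. Qed.

Lemma catal_is_linear : linear catal.
Proof.
move=> c l l'; apply/row_matrixP => b.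
by rewrite linearP /= !row_catal mulmxDl scalemxAl.
Qed.

HB.instance Definition _ := GRing.isLinear.Build R _ _ _ catal catal_is_linear.

(* In degree d + d', the transpose of the map sending (a_i) to the sum of the a_i f_i,
   where the rows of [f] are the coefficients of the forms f_i of degree d. *)
Definition mult_tr (f : 'M[R]_(r, nmon n d)) : 'M[R]_(nmon n (d + d'), r * nmon n d') :=
  lin1_mx (fun l => mxvec (f *m catal l)).

Lemma mul_mult_tr l f : l *m mult_tr f = mxvec (f *m catal l).
Proof. by rewrite -[RHS](mul_rV_lin1 (mxvec \o mulmx f \o catal)). Qed.
End Catalecticant.

Lemma dot_mxvec (R : comNzRingType) m n (A B : 'M[R]_(m, n)) :
  mxvec A *m (mxvec B)^T = (\tr (A *m B^T))%:M.
Proof.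
apply/matrixP => i j; rewrite !ord1 !mxE eqxx mulr1n.
rewrite (reindex _ (curry_mxvec_bij m n)) /=.
transitivity (\sum_i \sum_j A i j * B i j).
  by rewrite pair_bigA; apply: eq_bigr => -[k l] _ /=; rewrite mxE !mxvecE.
by apply: eq_bigr => k _; rewrite mxE; apply: eq_bigr => l _; rewrite mxE.
Qed.

(** The saving b (N - b) cancels the exponent in [card_subspace_frames]. *)
Lemma surj_arith N M r b q : (0 < N)%N -> (b <= N)%N ->
  (N * q + b * N ^ 2 <= b * M + N * b ^ 2)%N -> (M <= r * N)%N ->
  (q <= r * b - b * (N - b))%N.
Proof.
move=> N0 bN le Mr; rewrite leq_subRL.
  rewrite -(leq_pmul2l N0); nia.
nia.
Qed.

(** Here b is N minus the rank a of a relation; a (N - a + r) then bounds from below the number of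
    independent conditions the relation imposes on the forms. *)
Lemma inj_arith N M r b q : (b <= N)%N ->
  (N * q + b * N ^ 2 <= b * M + N * b ^ 2)%N -> (r * N <= M)%N -> (q <= M)%N ->
  ((N - b) * (b + r) <= M - q)%N.
Proof.
move=> bN le rN qM; have [->|N0] := posnP N; first by rewrite sub0n.
have [a Na] : exists a, N = (a + b)%N by exists (N - b)%N; rewrite subnK.
rewrite Na addnK in le rN N0 *; rewrite leq_subRL // -(leq_pmul2l N0).
nia.
Qed.

(** * Maximal rank over a large finite field *)

Section FiniteField.
Variables (F : finFieldType) (n d d' r : nat).
Hypothesis (d'0 : (0 < d')%N) (hd : (d' < d)%N).
Hypothesis hg : (sign_changes (gpoly d d') <= 1)%N.
Local Notation N := (nmon n d').
Local Notation M := (nmon n (d + d')).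
Local Notation D := (nmon n d).
Hypothesis hn : (N ^ 2 <= M)%N.
Hypothesis hF : (N.+1 * N ^ N < #|F|.-1)%N.

Let N0 : (0 < N)%N.
Proof. by rewrite bin_gt0 leq_addr. Qed.

Let leN a : (a <= N)%N -> (N ^ a <= N ^ N)%N.
Proof. by move=> aN; rewrite leq_pexp2l. Qed.

Lemma rank_catal_sub p q (V : 'M[F]_(p, N)) (U : 'M[F]_(q, M)) :
    (forall i, (catal (row i U) <= V)%MS) ->
  (N * \rank U + \rank V * N ^ 2 <= \rank V * M + N * \rank V ^ 2)%N.
Proof.
move=> UV; apply: rank_catalecticant => // b bd.
have [j <-] := mon_surj bd; apply/row_subP => i; rewrite row_mul -row_catal.
exact: submx_trans (row_sub _ _) (UV i).
Qed.

(** For the transpose, [row_free] means that multiplication is onto. A functional with catalecticant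
    of rank b kills the images of at most |F|^(r (D - b)) tuples, and there are at most N^b |F|^(r
    b) such functionals. *)
Lemma exists_mult_tr_free : (M <= r * N)%N ->
  exists f : 'M[F]_(r, D), row_free (mult_tr d' f).
Proof.
move=> MrN; have Nr : (N <= r)%N by rewrite -(leq_pmul2r N0) (leq_trans _ MrN).
pose Z (l : 'rV[F]_M) := [set f : 'M[F]_(r, D) | f *m catal l == 0].
have [||||||f Hf] := @exists_avoiding F _ _ _ Z (fun l => \rank (catal l))
   (fun b => #|F| ^ (r * (D - b)))%N N (N ^ N).
- by rewrite -cardsT; apply/card_gt0P; exists 0; rewrite inE.
- move=> c l c0; apply/setP => f; rewrite !inE linearZ /= -scalemxAr.
  by rewrite scaler_eq0 (negbTE c0).
- by move=> l; exact: rank_leq_col.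
- move=> l; rewrite -mxrank_ker; apply: leq_trans (card_submx r (kermx (catal l))).
  by apply/subset_leq_card/subsetP => f; rewrite !inE => /eqP /sub_kermxP.
(* An existing functional of rank b yields b <= D, so that D - b is not truncated. *)
- move=> b bN; have [->|[l0]] := set_0Vmem [set l : 'rV[F]_M | \rank (catal l) == b].
    by rewrite cards0.
  rewrite inE => /eqP lb; have bD : (b <= D)%N by rewrite -lb rank_leq_row.
  (* [U X] is the space of functionals whose catalecticant has its rows in the row space of [X]. *)
  pose U (X : 'M[F]_(b, N)) :=
    kermx (lin1_mx (fun l : 'rV[F]_M => mxvec (catal l *m cokermx X))).
  have inU X (l : 'rV_M) : (l <= U X)%MS = (catal l <= X)%MS.
    rewrite sub_kermx; set A := lin1_mx _.
    have -> : l *m A = mxvec (catal l *m cokermx X).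
      by rewrite -[RHS](mul_rV_lin1 (mxvec \o mulmxr (cokermx X) \o @catal F n d d')).
    by rewrite mxvec_eq0 submxE.
  have brbN : (b * (N - b) <= r * b)%N.
    by rewrite mulnC leq_mul2r (leq_trans (leq_subr _ _)) ?orbT.
  have rU X : X \in subspace_frames F b N -> (\rank (U X) <= r * b - b * (N - b))%N.
    move=> XG; have le := @rank_catal_sub _ _ X (U X).
    rewrite (rank_subspace_frame XG) in le.
    by apply: (surj_arith N0 bN (le _) MrN) => i; rewrite -inU row_sub.
  apply: leq_trans (_ : (N ^ b * #|F| ^ (r * b)) * #|F| ^ (r * (D - b)) <= _)%N.
    rewrite leq_mul2r; apply/orP; right.
    apply: leq_trans (@card_le_sum _ _ (mem (subspace_frames F b N)) _
        (fun X => [set l : 'rV[F]_M | (l <= U X)%MS]) _) _.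
      move=> l; rewrite inE => /eqP {}lb; have := subspace_frameP (catal l).
      by rewrite lb => -[X XG lX]; exists X; rewrite // inE inU.
    apply: leq_trans (_ : \sum_(X in subspace_frames F b N)
        #|F| ^ (r * b - b * (N - b)) <= _)%N.
      apply: leq_sum => X XG; apply: leq_trans (card_submx _ _) _.
      by rewrite mul1n leq_pexp2l ?rU // ltnW // finRing_gt1.
    rewrite sum_nat_const.
    apply: leq_trans (leq_mul (card_subspace_frames F b N) (leqnn _)) _.
    by rewrite -mulnA -expnD subnKC.
  rewrite -mulnA -expnD -mulnDr subnKC // card_mx.
  by rewrite leq_mul2r leN ?orbT.
- exact: hF.
exists f; apply: inj_row_free => l.
rewrite mul_mult_tr => /eqP; rewrite mxvec_eq0 => fl.
by apply/eqP; apply: contraTT fl => /Hf; rewrite inE.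
Qed.

(** For the transpose, [row_full] means that multiplication is injective. There are at most N^a
    |F|^(a (N - a) + r a) relations of rank a, and each imposes at least a (N - a + r) independent
    conditions on f, the rank of [B T]. *)
Lemma exists_mult_tr_full : (r * N <= M)%N ->
  exists f : 'M[F]_(r, D), row_full (mult_tr d' f).
Proof.
move=> rNM.
pose B (T : 'M[F]_(r, N)) : 'M[F]_(M, r * D) :=
  lin1_mx (fun l => mxvec (T *m (catal l)^T)).
have mulB T l : l *m B T = mxvec (T *m (catal l)^T).
  by rewrite -[RHS](mul_rV_lin1 (mxvec \o mulmx T \o trmx \o @catal F n d d')).
(* Both sides evaluate the trace of f (catal l) T^T, which is linear in each of l, f and T. *)
have mult_trB f T : mult_tr d' f *m (mxvec T)^T = B T *m (mxvec f)^T.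
  apply/row_matrixP => i; rewrite !row_mul !rowE mul_mult_tr mulB !dot_mxvec.
  by rewrite -[in LHS]mxtrace_tr !trmx_mul trmxK mulmxA.
have rB T : (\rank T * (N - \rank T + r) <= \rank (B T))%N.
  pose V := kermx T^T.
  have rV : \rank V = (N - \rank T)%N by rewrite mxrank_ker mxrank_tr.
  have le := @rank_catal_sub _ _ V (kermx (B T)).
  have rT := rank_leq_col T.
  rewrite rV mxrank_ker in le.
  have := inj_arith (leq_subr _ _) (le _) rNM (leq_subr _ _).
  rewrite (subKn rT) subKn ?rank_leq_row //; apply => i.
  apply/sub_kermxP/trmx_inj; rewrite trmx_mul trmxK trmx0.
  apply/eqP; rewrite -mxvec_eq0 -mulB; apply/eqP.
  by apply/sub_kermxP/row_sub.
pose Z (T : 'M[F]_(r, N)) := [set f : 'M[F]_(r, D) | mult_tr d' f *m (mxvec T)^T == 0].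
have [||||||f Hf] := @exists_avoiding F _ _ _ Z (fun T => \rank T)
   (fun a => #|F| ^ (r * D - a * (N - a + r)))%N N (N ^ N).
- by rewrite -cardsT; apply/card_gt0P; exists 0; rewrite inE.
- move=> c T c0; apply/setP => f; rewrite !inE linearZ /= linearZ /= -scalemxAr.
  by rewrite scaler_eq0 (negbTE c0).
- by move=> T; exact: rank_leq_col.
- move=> T; rewrite -(card_imset _ (can_inj (@mxvecK F r D))).
  apply: leq_trans (_ : #|[set v : 'rV[F]_(r * D) | (v <= kermx (B T)^T)%MS]| <= _)%N.
    apply/subset_leq_card/subsetP => v /imsetP[f]; rewrite !inE => /eqP e ->.
    by apply/sub_kermxP/trmx_inj; rewrite trmx_mul trmxK trmx0 -mult_trB.
  apply: leq_trans (card_submx _ _) _; rewrite mul1n mxrank_ker mxrank_tr.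
  by rewrite leq_pexp2l ?leq_sub2l // ltnW // finRing_gt1.
- move=> a aN; have [->|[T0]] := set_0Vmem [set T : 'M[F]_(r, N) | \rank T == a].
    by rewrite cards0.
  rewrite inE => /eqP Ta; have aD : (a * (N - a + r) <= r * D)%N.
    by rewrite -Ta (leq_trans (rB _)) // rank_leq_col.
  apply: leq_trans (_ : (N ^ a * #|F| ^ (a * (N - a)) * #|F| ^ (r * a)) *
      #|F| ^ (r * D - a * (N - a + r)) <= _)%N.
    rewrite leq_mul2r; apply/orP; right.
    apply: leq_trans (@card_le_sum _ _ (mem (subspace_frames F a N)) _
        (fun X => [set T : 'M[F]_(r, N) | (T <= X)%MS]) _) _.
      move=> T; rewrite inE => /eqP {}Ta; have := subspace_frameP T.
      by rewrite Ta => -[X XG TX]; exists X; rewrite // inE.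
    apply: leq_trans (_ : \sum_(X in subspace_frames F a N) #|F| ^ (r * a) <= _)%N.
      apply: leq_sum => X XG; apply: leq_trans (card_submx _ _) _.
      by rewrite (rank_subspace_frame XG).
    by rewrite sum_nat_const leq_mul2r card_subspace_frames orbT.
  rewrite -!mulnA -!expnD card_mx addnA [(r * a)%N]mulnC -mulnDr subnKC //.
  by rewrite leq_mul2r leN ?orbT.
- exact: hF.
exists f; rewrite /row_full -mxrank_tr; apply: inj_row_free => v.
rewrite -[v]vec_mxK => /(congr1 trmx); rewrite trmx_mul trmxK trmx0 => /eqP fv.
apply/eqP; rewrite mxvec_eq0; apply: contraTT fv => /Hf.
by rewrite inE.
Qed.

Lemma exists_mult_tr_rank :
  exists f : 'M[F]_(r, D), \rank (mult_tr d' f) = minn M (r * N).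
Proof.
have [MrN|rNM] := leqP M (r * N); last have {}rNM := ltnW rNM.
  by have [f /eqP] := exists_mult_tr_free MrN; exists f.
by have [f /eqP] := exists_mult_tr_full rNM; exists f.
Qed.
End FiniteField.

(** * Infinite fields *)

Lemma base_expansion_inj b n (f g : 'I_n -> nat) :
    (forall i, f i < b)%N -> (forall i, g i < b)%N ->
    (\sum_(i < n) f i * b ^ i = \sum_(i < n) g i * b ^ i)%N -> f =1 g.
Proof.
elim: n f g => [|n IHn] f g fb gb; first by move=> _ [].
rewrite !big_ord_recl /= !expn0 !muln1.
have shift (h : 'I_n.+1 -> nat) : (\sum_(i < n) h (lift ord0 i) * b ^ bump 0 i =
    (\sum_(i < n) h (lift ord0 i) * b ^ i) * b)%N.
  by rewrite big_distrl; apply: eq_bigr => i _; rewrite /bump add1n expnSr mulnA.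
rewrite !shift => e i.
have b0 : (0 < b)%N by apply: leq_ltn_trans (fb ord0).
have e0 : f ord0 = g ord0.
  by have := congr1 (modn^~ b) e; rewrite ![(_ + _ * b)%N]addnC !modnMDl !modn_small.
have [j ->|->//] := unliftP ord0 i.
apply: (IHn (f \o lift ord0) (g \o lift ord0)) => [k|k|] /=.
- exact: fb.
- exact: gb.
- by move: e; rewrite e0 => /addnI /eqP; rewrite eqn_pmul2r // => /eqP.
Qed.

Lemma infinite_uniq (k : fieldType) (hk : infinite_field k) m :
  exists2 s : seq k, uniq s & size s = m.
Proof.
elim: m => [|m [s us sm]]; first by exists [::].
by have [x xs] := hk s; exists (x :: s); rewrite /= ?xs ?us ?sm.
Qed.

Lemma infinite_nonroot (k : fieldType) (hk : infinite_field k) (p : {poly k}) :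
  p != 0 -> exists x, p.[x] != 0.
Proof.
move=> p0; have [s us sp] := infinite_uniq hk (size p).
have /allPn[x _ px] : ~~ all (root p) s.
  by apply/negP => /(max_poly_roots p0) /(_ us); rewrite sp ltnn.
by exists x.
Qed.

(* Kronecker substitution: [x_i := x ^ (b ^ i)] keeps the monomials of [p]
   distinct when the base [b] exceeds all exponents. *)
Lemma infinite_meval_neq0 (k : fieldType) (hk : infinite_field k) n
    (p : {mpoly k[n]}) : p != 0 -> exists v : 'I_n -> k, p.@[v] != 0.
Proof.
move=> p0; pose b := msize p; pose e (m : 'X_{1..n}) := (\sum_(i < n) m i * b ^ i)%N.
have mb m i : m \in msupp p -> (m i < b)%N.
  move=> /msize_mdeg_lt; apply: leq_ltn_trans.
  by rewrite mdegE (bigD1 i) //= leq_addr.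
pose Q := \sum_(m <- msupp p) p@_m *: 'X^(e m).
have Q0 : Q != 0.
  have m0 := mlead_supp p0; apply: contraTneq (m0) => Q0.
  rewrite mcoeff_msupp negbK -(coef0 _ (e (mlead p))) -Q0 coef_sum.
  rewrite (bigD1_seq (mlead p)) ?msupp_uniq //= coefZ coefXn eqxx mulr1.
  rewrite big_seq_cond big1 ?addr0 // => m /andP[mp mm].
  rewrite coefZ coefXn; case: eqP => [/esym E|]; last by rewrite mulr0.
  case/eqP: mm; apply/mnmP; apply: base_expansion_inj (E) => i; exact: mb.
have [x Qx] := infinite_nonroot hk Q0; exists (fun i => x ^+ (b ^ i)).
rewrite mevalE; move: Qx; rewrite /Q horner_sum; congr (_ != 0).
apply: eq_bigr => m _; rewrite hornerZ hornerXn; congr (_ * _).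
by rewrite /e expr_sum; apply: eq_bigr => i _; rewrite mulnC exprM.
Qed.

(** Lets one matrix with indeterminate entries over the integers specialise to every field. *)
Lemma map_mult_tr (R S : comNzRingType) (phi : {rmorphism R -> S}) n d d' r
    (f : 'M[R]_(r, nmon n d)) :
  map_mx phi (mult_tr d' f) = mult_tr d' (map_mx phi f).
Proof.
apply/matrixP => i j; rewrite !mxE.
case/mxvec_indexP: j => a c; rewrite !mxvecE !mxE rmorph_sum; apply: eq_bigr => b _.
rewrite rmorphM !mxE; congr (_ * _); rewrite rmorph_sum; apply: eq_bigr => l _.
by rewrite !mxE rmorphM !rmorph_nat.
Qed.

Lemma unit_minor (F : fieldType) m n s (A : 'M[F]_(m, n)) : \rank A = s ->
  exists (g : 'I_s -> 'I_m) (h : 'I_s -> 'I_n), \det (mxsub g h A) != 0.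
Proof.
move=> <-.
pose A1 := rowsub (maxrankfun A) A.
have fA1 : row_full A1^T by rewrite /row_full mxrank_tr; exact: maxrowsub_free.
exists (maxrankfun A), (fullrankfun fA1); rewrite -unitfE -unitmxE -unitmx_tr.
have := fullrowsub_unit fA1; congr (_ \in unitmx).
by apply/matrixP => i j; rewrite !mxE.
Qed.

Lemma rank_ge_minor (F : fieldType) m n s (A : 'M[F]_(m, n))
    (g : 'I_s -> 'I_m) (h : 'I_s -> 'I_n) :
  \det (mxsub g h A) != 0 -> (s <= \rank A)%N.
Proof.
rewrite -unitfE -unitmxE => /mxrank_unit <-.
rewrite mxsubcr -[rowsub g A]mulmx1 -mulmx_colsub rowsubE.
exact: leq_trans (mxrankM_maxl _ _) (mxrankM_maxr _ _).
Qed.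

(* Some maximal minor of the generic [mult_tr], a polynomial with integer
   coefficients, has a coefficient prime to [p]: it does not vanish over a large
   finite field of characteristic [p]. *)
Lemma mult_tr_rank_char (k : fieldType) (hk : infinite_field k) n d d' r p :
    (0 < d')%N -> (d' < d)%N -> (sign_changes (gpoly d d') <= 1)%N ->
    (nmon n d' ^ 2 <= nmon n (d + d'))%N -> prime p ->
  exists2 c : int, ~~ (p %| c)%Z & c%:~R != 0 :> k ->
    exists f : 'M[k]_(r, nmon n d),
      \rank (mult_tr d' f) = minn (nmon n (d + d')) (r * nmon n d').
Proof.
move=> d'0 hd hg hn pp; set N := nmon n d' in hn *; set M := nmon n _ in hn *.
(* The exponent e = (N + 1) N^N + 1 makes [F] large enough because p^e > e. *)
have [F pF cF] := pPrimePowerField pp (ltn0Sn (N.+1 * N ^ N)).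
have hF : (N.+1 * N ^ N < #|F|.-1)%N.
  by rewrite -ltnS prednK cF ?expn_gt0 ?prime_gt0 // ltn_expl ?prime_gt1.
have [f0 rf0] := exists_mult_tr_rank r d'0 hd hg hn hF.
have [g [h gh0]] := unit_minor rf0.
pose X : 'M[{mpoly int[r * nmon n d]}]_(r, nmon n d) :=
  \matrix_(i, j) 'X_(mxvec_index i j).
pose P := \det (mxsub g h (mult_tr d' X)).
have evP (K : fieldType) (v : 'rV[K]_(r * nmon n d)) :
    (map_mpoly intr P).@[v 0] = \det (mxsub g h (mult_tr d' (vec_mx v))).
  rewrite -[LHS]/((meval (v 0) \o map_mpoly intr) P) -det_map_mx map_mxsub map_mult_tr.
  congr (\det (mxsub g h (mult_tr d' _))); apply/matrixP => i j.
  by rewrite !mxE /= map_mpolyX mevalXU.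
have PF : map_mpoly intr P != 0 :> {mpoly F[_]}.
  apply: contraNneq gh0 => P0; have := evP F (mxvec f0).
  by rewrite mxvecK P0 meval0 => <-.
(* The coefficient sits at the leading monomial of the image of [P] over [F], so it is nonzero
   there. *)
exists P@_(mlead (map_mpoly intr P : {mpoly F[_]})).
  by rewrite (dvdz_pcharf pF) -mcoeff_map_mpoly mleadc_eq0.
move=> ck; have [|v] := @infinite_meval_neq0 k hk _ (map_mpoly intr P).
  by apply: contraNneq ck => Pk; rewrite -mcoeff_map_mpoly Pk mcoeff0.
have vE : v =1 (\row_i v i) 0 by move=> i; rewrite mxE.
rewrite (meval_eq _ vE) evP => /rank_ge_minor rk.
exists (vec_mx (\row_i v i)); apply/eqP; rewrite eqn_leq rk andbT leq_min.
by rewrite rank_leq_row rank_leq_col.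
Qed.

(** The prime 2 suffices unless its coefficient vanishes in [k]. Then [k] has positive
    characteristic p, and the coefficient obtained for p cannot vanish. *)
Lemma mult_tr_rank_infinite (k : fieldType) (hk : infinite_field k) n d d' r :
    (0 < d')%N -> (d' < d)%N -> (sign_changes (gpoly d d') <= 1)%N ->
    (nmon n d' ^ 2 <= nmon n (d + d'))%N ->
  exists f : 'M[k]_(r, nmon n d),
    \rank (mult_tr d' f) = minn (nmon n (d + d')) (r * nmon n d').
Proof.
move=> d'0 hd hg hn.
have rank_char p := @mult_tr_rank_char k hk n d d' r p d'0 hd hg hn.
have [//|c c2 H] := rank_char 2%N.
have [c0|/H//] := eqVneq (c%:~R : k) 0.
have [p pk] : exists p, p \in [pchar k].
  apply: (@natf0_pchar _ `|c|%N).
    by rewrite absz_gt0; apply: contraNneq c2 => ->; exact: dvdz0.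
  have := c0; case: (intP c) => [|m|m]; rewrite ?absz0 ?abszN ?absz_nat //.
    by move/eqP.
  by rewrite mulrNz => /eqP; rewrite oppr_eq0.
have [|c' c'p] := rank_char p; first by have /andP[] := pk.
by apply; rewrite -(dvdz_pcharf pk).
Qed.

(** * Forms and ideals *)

Lemma dim_formsE (k : fieldType) n e : dim_forms k n e = nmon n e.
Proof. by rewrite /dim_forms dimvf. Qed.

Section Forms.
Variables (k : fieldType) (n : nat).

Definition form e (u : 'rV[k]_(nmon n e)) : {mpoly k[n.+1]} :=
  \sum_c u 0 c *: 'X_[mon c].

Definition coords e (p : {mpoly k[n.+1]}) : 'rV[k]_(nmon n e) := \row_c p@_(mon c).

Lemma form_homog e (u : 'rV_(nmon n e)) : form u \is e.-homog.
Proof. by apply: rpred_sum => c _; rewrite rpredZ // dhomogX; apply/eqP/mdeg_mon. Qed.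

Lemma coords_form e (u : 'rV_(nmon n e)) : coords e (form u) = u.
Proof.
apply/rowP => c; rewrite mxE raddf_sum (bigD1 c) //= mcoeffZ mcoeffX eqxx mulr1.
rewrite big1 ?addr0 // => b bc.
by rewrite mcoeffZ mcoeffX (inj_eq (@mon_inj _ _)) (negbTE bc) mulr0.
Qed.

Lemma coords_inj e (p q : {mpoly k[n.+1]}) : p \is e.-homog -> q \is e.-homog ->
  coords e p = coords e q -> p = q.
Proof.
move=> hp hq E; apply/mpolyP => m; have [me|me] := eqVneq (mdeg m) e.
  by have [c <-] := mon_surj me; have /rowP/(_ c) := E; rewrite !mxE.
by rewrite (dhomog_nemf_coeff hp me) (dhomog_nemf_coeff hq me).
Qed.

Definition dcoords e (p : dhomog n.+1 k e) := coords e p.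

Lemma dcoords_is_linear e : linear (@dcoords e).
Proof. by move=> a p q; apply/rowP => c; rewrite !mxE /= mcoeffD mcoeffZ. Qed.

HB.instance Definition _ e := GRing.isLinear.Build k (dhomog n.+1 k e)
  'rV[k]_(nmon n e) _ (@dcoords e) (@dcoords_is_linear e).

Lemma mcoeff_mulX d e (a : {mpoly k[n.+1]}) (b : 'X_{1..n.+1}) (c : 'I_(nmon n e)) :
    e = (mdeg b + d)%N ->
  (a * 'X_[b])@_(mon c) = \sum_(l < nmon n d) a@_(mon l) * (mon c == (mon l + b)%MM)%:R.
Proof.
move=> eE; have [bc|bc] := boolP (b <= mon c)%MM.
  have cE : mon c = (b + (mon c - b))%MM by rewrite addmC submK.
  have [|l lE] := @mon_surj n d (mon c - b).
    apply: (@addnI (mdeg b)); rewrite -eE -mdegD -cE.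
    exact: mdeg_mon.
  rewrite {1}cE mcoeffMX -lE (bigD1 l) //= lE submK // eqxx mulr1 big1 ?addr0 //.
  move=> j jl; case: eqP => [E|]; last by rewrite mulr0.
  case/eqP: jl; apply: mon_inj; rewrite lE E.
  by apply/mnmP => i; rewrite mnmBE mnmDE addnK.
rewrite big1 => [|l _]; last first.
  by case: eqP bc => [->|]; [rewrite lem_addl | rewrite mulr0].
apply/eqP; rewrite mcoeff_eq0 (perm_mem (msuppMX _ _)).
by apply: contra bc => /mapP[m _ ->]; rewrite lem_addr.
Qed.

(** The [a i] are arbitrary polynomials, but only their parts of degree d' reach degree d + d'.
    Hence the forms of that degree in the ideal have coordinates in the row space of the transpose
    of [mult_tr d' v]. *)
Lemma coords_ideal d d' r (v : 'M[k]_(r, nmon n d)) (a : 'I_r -> {mpoly k[n.+1]}) :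
  coords (d + d') (\sum_i a i * form (row i v)) =
  mxvec (\matrix_(i, l) (a i)@_(mon l)) *m (mult_tr d' v)^T.
Proof.
apply/rowP => c; rewrite !mxE.
set T := \matrix_(i, l) _.
transitivity (\tr (T *m (v *m catal (delta_mx 0 c))^T)).
  rewrite raddf_sum; apply: eq_bigr => i _ /=.
  rewrite mulr_sumr raddf_sum /= mxE.
  under eq_bigr => b _.
    rewrite -scalerAr mcoeffZ (@mcoeff_mulX d'); last by rewrite mdeg_mon.
    rewrite mulr_sumr; over.
  rewrite exchange_big /=; apply: eq_bigr => l _.
  rewrite !mxE mulr_sumr; apply: eq_bigr => b _.
  by rewrite mxE [catal _ _ _]mxE -rowE !mxE mulrCA.
have := dot_mxvec T (v *m catal (delta_mx 0 c)).
rewrite -mul_mult_tr -rowE => /matrixP/(_ 0 0); rewrite !mxE eqxx mulr1n => <-.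
by apply: eq_bigr => j _; rewrite !mxE.
Qed.
End Forms.


(** A column basis of the cokernel matrix presents the quotient by the row space of [A] as k^m. *)
Lemma coker_matrix (k : fieldType) p n m (A : 'M[k]_(p, n)) : (n - \rank A)%N = m ->
  exists2 Q : 'M[k]_(n, m), row_full Q &
    forall u : 'rV_n, (u *m Q == 0) = (u <= A)%MS.
Proof.
rewrite -mxrank_coker => <-; exists (col_base (cokermx A)).
  exact: col_base_full.
move=> u; rewrite submxE -[in RHS](mulmx_base (cokermx A)) mulmxA.
by rewrite [in RHS]mulmx_free_eq0 ?row_base_free.
Qed.

Theorem theorem5 (k : fieldType) (hk : infinite_field k)
    (d d' : nat) (hd' : (0 < d')%N) (hd : (d' < d)%N)
    (hg : (sign_changes (gpoly d d') <= 1)%N)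
    (n : nat) (* the number of variables is n.+1 *)
    (hn : (dim_forms k n d' ^ 2 <= dim_forms k n (d + d'))%N)
    (r : nat) (hr : (0 < r)%N) :
  exists f : 'I_r -> {mpoly k[n.+1]},
    (forall i : 'I_r, f i \is d.-homog) /\
    quotient_dim (ideal_gen f) (d + d') (froberg_value k n r d d').
Proof.
rewrite /froberg_value !dim_formsE in hn *.
have [v rv] := mult_tr_rank_infinite hk r hd' hd hg hn.
exists (fun i => form (row i v)); split=> [i|]; first exact: form_homog.
pose m := (nmon n (d + d') - r * nmon n d')%N.
(* M - min(M, r N) is the truncated difference M - r N, which covers both cases of the maximum. *)
have [|Q Qfull QE] := @coker_matrix k _ _ m (mult_tr d' v)^T.
  by rewrite mxrank_tr rv /minn; case: ltnP => // /ltnW; rewrite subnn => /eqP.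
pose phi : {linear dhomog n.+1 k (d + d') -> 'rV[k]_m} :=
  mulmxr Q \o @dcoords k n (d + d').
exists phi; split=> [u|p].
  have /submxP[w ->] : (u <= Q)%MS by rewrite submx_full.
  by exists (DHomog (form_homog w)); rewrite /phi /= /dcoords coords_form.
split=> [/eqP|[a pE]].
  rewrite QE => /submxP[w]; rewrite /= /dcoords => wE.
  exists (fun i => form (row i (vec_mx w))); apply: (@coords_inj k n (d + d')).
  - exact: dhomog_is_dhomog.
  - apply: rpred_sum => i _; rewrite addnC; apply: dhomogM; exact: form_homog.
  rewrite coords_ideal wE -{1}(vec_mxK w); congr (mxvec _ *m _).
  apply/matrixP => i l; rewrite mxE.
  by have /rowP/(_ l) := coords_form (row i (vec_mx w)); rewrite !mxE.
by apply/eqP; rewrite QE /= /dcoords pE coords_ideal submxMl.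
Qed.
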